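(* Let $0<\rho<\sigma<1$, $\zeta>1$, and let $G_1,\dots,G_m:\mathbb{R}^n\to\mathcal{I}(\mathbb{R})$ be $gH$-continuously differentiable interval-valued maps. Let $(x^k),(d^k),(t_k),(\beta_k)$ be infinite sequences generated by the nonlinear conjugate gradient scheme described in the context, and let $L_0=\{x\in\mathbb{R}^n: G_i(x)\preceq G_i(x^0)\text{ for all }i=1,\dots,m\}$. Assume: (1) for each $i=1,\dots,m$, $\nabla_{gH}G_i$ is $gH$-Lipschitz continuous on $L_0$ with some constant $L_i$; (2) for every sequence $(y^k)$ in $L_0$ with $G_i(y^{k+1})\preceq G_i(y^k)$ for all $k$ and all $i=1,\dots,m$, there exist $\mathcal{G}_1,\dots,\mathcal{G}_m\in\mathcal{I}(\mathbb{R})$ such that $\mathcal{G}_i\preceq G_i(y^k)$ for all $k$ and all $i$. Suppose that for all $k\ge1$ $$\beta_k=\beta_k^{mDY}:=\frac{-\psi\circ\phi_{x^k}(v(x^k))}{\psi\circ\phi_{x^k}(d^{k-1})-\zeta\,\psi\circ\phi_{x^{k-1}}(d^{k-1})}.$$ If $t_k$ satisfies the strong Wolfe conditions for all $k\ge0$, then $\liminf_{k\to\infty}\|v(x^k)\|=0$.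
   Context: $\|\cdot\|$ is the Euclidean norm. $\mathcal{I}(\mathbb{R})$ is the set of closed bounded intervals of $\mathbb{R}$. For $A=[a_1,a_2]$, $B=[b_1,b_2]$ in $\mathcal{I}(\mathbb{R})$ and $\alpha\in\mathbb{R}$: $A\oplus B=[a_1+b_1,a_2+b_2]$; $\alpha\odot A=A\odot\alpha=[\min\{\alpha a_1,\alpha a_2\},\max\{\alpha a_1,\alpha a_2\}]$; $A\preceq B$ means $a_1\le b_1$ and $a_2\le b_2$. Write $G_i=[\underline{G}_i,\overline{G}_i]$ with real-valued endpoint functions $\underline{G}_i\le\overline{G}_i$. ''$gH$-continuously differentiable'' means that the endpoint functions are differentiable and the $gH$-gradient $\nabla_{gH}G_i(x)$ is continuous in $x$, where $\nabla_{gH}G_i(x)$ is the vector of intervals whose $j$-th component is $[\underline{\nabla_{gH}G_i}(x)_j,\overline{\nabla_{gH}G_i}(x)_j]$ with $$\underline{\nabla_{gH}G_i}(x)_j=\min\{\partial_j\underline{G}_i(x),\partial_j\overline{G}_i(x)\},\qquad \overline{\nabla_{gH}G_i}(x)_j=\max\{\partial_j\underline{G}_i(x),\partial_j\overline{G}_i(x)\};$$ continuity means that the maps $\underline{\nabla_{gH}G_i},\overline{\nabla_{gH}G_i}:\mathbb{R}^n\to\mathbb{R}^n$ are continuous, and $gH$-Lipschitz continuity of $\nabla_{gH}G_i$ on $L_0$ with constant $L_i$ means that both of these maps are Lipschitz on $L_0$ with constant $L_i$ (Euclidean norm). For $x,v\in\mathbb{R}^n$, with $|v|=(|v_1|,\dots,|v_n|)^\top$,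 $$\psi\circ\phi_x(v):=\max_{1\le i\le m}\Big[\tfrac12\big(\underline{\nabla_{gH}G_i}(x)+\overline{\nabla_{gH}G_i}(x)\big)^\top v+\tfrac12\big(\overline{\nabla_{gH}G_i}(x)-\underline{\nabla_{gH}G_i}(x)\big)^\top|v|\Big].$$ For $x\in\mathbb{R}^n$, $v(x)$ is the unique minimizer and $\xi(x)$ the minimum value of the strongly convex function $v\mapsto\psi\circ\phi_x(v)+\tfrac12\|v\|^2$ over $\mathbb{R}^n$. Nonlinear conjugate gradient scheme: given $x^0\in\mathbb{R}^n$ and real parameters $\beta_k$ ($k\ge1$), $d^0=v(x^0)$, $d^k=v(x^k)+\beta_kd^{k-1}$ for $k\ge1$, and $x^{k+1}=x^k+t_kd^k$ with step lengths $t_k>0$. It is assumed throughout that the scheme produces infinite sequences with $\xi(x^k)\ne0$ and $v(x^k)\neq0$ for all $k$ (no stopping). Strong Wolfe conditions for $t_k$: $G_i(x^k+t_kd^k)\preceq G_i(x^k)\oplus[\rho t_k,\rho t_k]\odot\psi\circ\phi_{x^k}(d^k)$ for $i=1,\dots,m$, and $|\psi\circ\phi_{x^k+t_kd^k}(d^k)|\le\sigma\,|\psi\circ\phi_{x^k}(d^k)|$. *)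

(* Defs.v *)
From HB Require Import structures.
From mathcomp Require Import all_boot all_order all_algebra.
From mathcomp Require Import all_classical all_reals all_analysis.

Set Implicit Arguments.
Unset Strict Implicit.
Unset Printing Implicit Defensive.

Import Order.TTheory GRing.Theory Num.Theory.
Import numFieldNormedType.Exports.

Local Open Scope classical_set_scope.
Local Open Scope ring_scope.

Section closed_bounded_intervals.
Context {R : realType}.

Record cbitv := CBItv { ilo : R; ihi : R; ilo_le_ihi : ilo <= ihi }.

Implicit Types A B : cbitv.

Fact iadd_subproof A B : ilo A + ilo B <= ihi A + ihi B.
Proof. exact: lerD (ilo_le_ihi A) (ilo_le_ihi B). Qed.

Definition iadd A B : cbitv := CBItv (iadd_subproof A B).

Fact min_le_max (a b : R) : Num.min a b <= Num.max a b.
Proof. by rewrite ge_min !le_max lexx. Qed.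

Definition iscale (a : R) A : cbitv :=
  CBItv (min_le_max (a * ilo A) (a * ihi A)).

Definition ipoint (a : R) : cbitv := CBItv (lexx a).

Definition ipreceq A B : Prop := ilo A <= ilo B /\ ihi A <= ihi B.

End closed_bounded_intervals.
Arguments cbitv : clear implicits.

Section vectors.
Context {R : realType} {n : nat}.
Implicit Types u v : 'rV[R]_n.

Definition dot u v : R := \sum_(j < n) u 0 j * v 0 j.

(* The library norm `|v| on row vectors is the sup norm, hence this one. *)
Definition enorm v : R := Num.sqrt (\sum_(j < n) v 0 j ^+ 2).

Definition vabs v : 'rV[R]_n := \row_j `|v 0 j|.

Definition partial (f : 'rV[R]_n -> R) (x : 'rV[R]_n) (j : 'I_n) : R :=
  'D_(delta_mx 0 j) f x.

End vectors.

Section gH_calculus.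
Context {R : realType} {n : nat}.
Implicit Types (F : 'rV[R]_n -> cbitv R) (x : 'rV[R]_n).

Definition gH_grad F x (j : 'I_n) : cbitv R :=
  CBItv (min_le_max (partial (fun y => ilo (F y)) x j)
                    (partial (fun y => ihi (F y)) x j)).

Definition gH_grad_lo F x : 'rV[R]_n := \row_j ilo (gH_grad F x j).
Definition gH_grad_hi F x : 'rV[R]_n := \row_j ihi (gH_grad F x j).

Definition gH_continuously_differentiable F : Prop :=
  [/\ forall x, differentiable (fun y => ilo (F y)) x,
      forall x, differentiable (fun y => ihi (F y)) x,
      continuous (gH_grad_lo F) & continuous (gH_grad_hi F)].

Definition gH_grad_lipschitz_on (D : set 'rV[R]_n) (L : R) F : Prop :=
  forall x y, D x -> D y ->
    enorm (gH_grad_lo F x - gH_grad_lo F y) <= L * enorm (x - y) /\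
    enorm (gH_grad_hi F x - gH_grad_hi F y) <= L * enorm (x - y).

End gH_calculus.

(* The objectives are indexed by 'I_m.+1: their number is m + 1 >= 1. *)
Section descent_direction.
Context {R : realType} {m n : nat}.
Variable G : 'I_m.+1 -> 'rV[R]_n -> cbitv R.
Implicit Types x v : 'rV[R]_n.

Definition psi_phi_comp x v (i : 'I_m.+1) : R :=
  2^-1 * dot (gH_grad_lo (G i) x + gH_grad_hi (G i) x) v +
  2^-1 * dot (gH_grad_hi (G i) x - gH_grad_lo (G i) x) (vabs v).

Definition psi_phi x v : R :=
  \big[Num.max/psi_phi_comp x v ord0]_(i < m.+1) psi_phi_comp x v i.

Definition dir_objective x v : R := psi_phi x v + 2^-1 * enorm v ^+ 2.

(* The minimizer exists and is unique by strong convexity, so the default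
   value 0 of [xget] is never used as such. *)
Definition vdir x : 'rV[R]_n :=
  xget 0 [set v | forall w, dir_objective x v <= dir_objective x w].

Definition xi x : R := dir_objective x (vdir x).

Definition level_set x0 : set 'rV[R]_n :=
  [set x | forall i, ipreceq (G i x) (G i x0)].

End descent_direction.

Section conjugate_gradient.
Context {R : realType} {m n : nat}.
Variable G : 'I_m.+1 -> 'rV[R]_n -> cbitv R.
Implicit Types (x d : nat -> 'rV[R]_n) (t beta : nat -> R).

(* [beta 0] is not used. The last two clauses say that the scheme
   never stops. *)
Definition ncg_scheme beta x d t : Prop :=
  [/\ d 0%N = vdir G (x 0%N),
      forall k, d k.+1 = vdir G (x k.+1) + beta k.+1 *: d k,
      forall k, 0 < t k /\ x k.+1 = x k + t k *: d k,
      forall k, xi G (x k) != 0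
    & forall k, vdir G (x k) != 0].

Definition strong_wolfe (rho sigma : R) (x d : 'rV[R]_n) (t : R) : Prop :=
  (forall i, ipreceq (G i (x + t *: d))
     (iadd (G i x) (iscale (psi_phi G x d) (ipoint (rho * t))))) /\
  `|psi_phi G (x + t *: d) d| <= sigma * `|psi_phi G x d|.

(* The value of the parameter at step k.+1, from x^k, x^{k+1} and d^k. *)
Definition beta_mDY (zeta : R) (xk xk1 dk : 'rV[R]_n) : R :=
  - psi_phi G xk1 (vdir G xk1) /
  (psi_phi G xk1 dk - zeta * psi_phi G xk dk).

End conjugate_gradient.

(* Main.v *)
Require Import Defs.
From mathcomp Require Import all_boot all_order all_algebra.
From mathcomp Require Import all_classical all_reals all_analysis.
From mathcomp Require Import lra.

(** Write [f_k] for [psi_phi G (x k) (d k)], the generalized directional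
derivative along the search direction, and [v_k] for [vdir G (x k)].

The function [psi_phi G x] is sublinear, so [f_k.+1] is at most
[psi_phi G (x k.+1) v_k.+1 + beta k.+1 * psi_phi G (x k.+1) (d k)].  The choice
of [beta k.+1] turns this bound into exactly [zeta * f_k * beta k.+1]
([mDY_scalar]), and with the curvature condition two things follow as long as
[f_k < 0]:
- [beta k.+1 <= `|f_k.+1| / (zeta * `|f_k|)];
- [`|f_k.+1| >= kappa * enorm v_k.+1 ^+ 2] for a constant [kappa > 0].
By induction every [d k] is a descent direction, and so the objectives decrease
and the iterates stay in the level set.

Suppose that [enorm v_k >= gamma > 0] from some rank on.  Dividing
[enorm (d k.+1) <= enorm v_k.+1 + beta k.+1 * enorm (d k)] by [`|f_k.+1|], the
ratios [r_k := enorm (d k) / `|f_k|] satisfy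
[r_k.+1 <= (kappa * gamma)^-1 + r_k / zeta].  Since [1 < zeta] this recursion is
a contraction, and [r_k] is bounded by some [M] ([direction_bounded]).  The terms
[r_k ^- 2] of the Zoutendijk series are then bounded below, and so is the
decrease of the objectives at each single step.  Indeed, by the curvature
condition and the Lipschitz gradients,
[(1 - sigma) * `|f_k| <= 2 * L * t k * enorm (d k) ^+ 2], and therefore
[t k * `|f_k| >= (1 - sigma) / (2 * L * M ^+ 2)] ([step_lower_bound]).  The
sufficient decrease condition then makes each objective drop by a fixed amount
at each step, which contradicts the lower bound along the iterates. *)

Import Order.TTheory GRing.Theory Num.Theory.
Import numFieldNormedType.Exports.

Local Open Scope classical_set_scope.
Local Open Scope ring_scope.

(** * Euclidean inner product and norm *)

Section euclidean.
Context {R : realType} {n : nat}.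
Implicit Types u v w : 'rV[R]_n.

Lemma enorm_ge0 v : 0 <= enorm v.
Proof. exact: sqrtr_ge0. Qed.

Lemma enorm0 : enorm (0 : 'rV[R]_n) = 0.
Proof. by rewrite /enorm big1 ?sqrtr0 // => j _; rewrite mxE expr0n. Qed.

Lemma enorm_sqr v : enorm v ^+ 2 = dot v v.
Proof.
rewrite /enorm sqr_sqrtr; first by apply: eq_bigr => j _; rewrite expr2.
by apply: sumr_ge0 => j _; apply: sqr_ge0.
Qed.

Lemma enorm_gt0 v : v != 0 -> 0 < enorm v.
Proof.
move=> v0; rewrite lt_def enorm_ge0 andbT; apply: contra v0 => /eqP ev.
have := enorm_sqr v; rewrite ev expr0n /= => /esym/eqP.
rewrite psumr_eq0; last by move=> j _; rewrite -expr2 sqr_ge0.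
move=> /allP v0; apply/eqP/rowP => j; rewrite mxE.
by have := v0 j (mem_index_enum j); rewrite /= mulf_eq0 orbb => /eqP.
Qed.

Lemma dotC u v : dot u v = dot v u.
Proof. by apply: eq_bigr => j _; rewrite mulrC. Qed.

Lemma dotDl u v w : dot (u + v) w = dot u w + dot v w.
Proof. by rewrite /dot -big_split; apply: eq_bigr => j _; rewrite mxE mulrDl. Qed.

Lemma dotZl (a : R) u v : dot (a *: u) v = a * dot u v.
Proof. by rewrite /dot mulr_sumr; apply: eq_bigr => j _; rewrite mxE mulrA. Qed.

Lemma dotBl u v w : dot (u - v) w = dot u w - dot v w.
Proof. by rewrite dotDl -scaleN1r dotZl mulN1r. Qed.

Lemma dotDr u v w : dot w (u + v) = dot w u + dot w v.
Proof. by rewrite dotC dotDl ![dot _ w]dotC. Qed.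

Lemma dotZr (a : R) u v : dot u (a *: v) = a * dot u v.
Proof. by rewrite dotC dotZl dotC. Qed.

Lemma dotr0 u : dot u 0 = 0.
Proof. by rewrite -(scale0r 0) dotZr mul0r. Qed.

Lemma ler_dot u v w : (forall j, 0 <= u 0 j) -> (forall j, v 0 j <= w 0 j) ->
  dot u v <= dot u w.
Proof. by move=> u0 vw; apply: ler_sum => j _; apply: ler_wpM2l. Qed.

Lemma cauchy_schwarz u v : dot u v <= enorm u * enorm v.
Proof.
have [->|/enorm_gt0 u0] := eqVneq u 0.
  by rewrite dotC dotr0 enorm0 mul0r.
have [->|/enorm_gt0 v0] := eqVneq v 0; first by rewrite dotr0 enorm0 mulr0.
(* Expanding this square gives 2ab(ab - c) >= 0, a and b being the norms and c
   the inner product. *)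
have := sqr_ge0 (enorm (enorm v *: u - enorm u *: v)).
rewrite enorm_sqr dotBl !dotZl ![dot _ (_ - _)]dotC !dotBl !dotZl -!enorm_sqr.
rewrite (dotC v u).
set a := enorm u in u0 *; set b := enorm v in v0 *; set c := dot u v => H.
have : 0 <= (2 * (a * b)) * (a * b - c) by apply: le_trans H _; lra.
by rewrite pmulr_rge0 ?subr_ge0 // !mulr_gt0.
Qed.

Lemma dot_le_enorm u v (c : R) : enorm u <= c -> dot u v <= c * enorm v.
Proof.
by move=> uc; rewrite (le_trans (cauchy_schwarz u v)) ?ler_wpM2r ?enorm_ge0.
Qed.

Lemma enormZ (a : R) v : enorm (a *: v) = `|a| * enorm v.
Proof.
apply/eqP; rewrite -(@eqrXn2 _ 2) ?mulr_ge0 ?enorm_ge0 //.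
by rewrite exprMn !enorm_sqr dotZl dotZr mulrA -expr2 real_normK ?num_real.
Qed.

Lemma ler_enormD u v : enorm (u + v) <= enorm u + enorm v.
Proof.
rewrite -(@ler_pXn2r _ 2) ?nnegrE ?addr_ge0 ?enorm_ge0 //.
rewrite enorm_sqr dotDl !dotDr sqrrD -!enorm_sqr (dotC v u).
by have := cauchy_schwarz u v; lra.
Qed.

Lemma enorm_vabs v : enorm (vabs v) = enorm v.
Proof.
congr (Num.sqrt _); apply: eq_bigr => j _.
by rewrite mxE real_normK ?num_real.
Qed.

End euclidean.

(** * The generalized directional derivative *)

Section psi_phi_theory.
Context {R : realType} {m n : nat}.
Variable G : 'I_m.+1 -> 'rV[R]_n -> cbitv R.
Implicit Types x y u v : 'rV[R]_n.

Lemma psi_phi_comp_le x v i : psi_phi_comp G x v i <= psi_phi G x v.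
Proof. exact: le_bigmax. Qed.

Lemma psi_phi_leP x v (c : R) :
  (forall i, psi_phi_comp G x v i <= c) -> psi_phi G x v <= c.
Proof. by move=> h; apply: bigmax_le. Qed.

Lemma gH_grad_width_ge0 i x j :
  0 <= (gH_grad_hi (G i) x - gH_grad_lo (G i) x) 0 j.
Proof. by rewrite !mxE subr_ge0; apply: ilo_le_ihi. Qed.

(** Each component is a linear form plus a combination of the [`|v j|] whose
coefficients, the widths of the gradient intervals, are nonnegative: it is
convex, and a maximum of convex functions is convex. *)
Lemma psi_phi_subadd x u v : psi_phi G x (u + v) <= psi_phi G x u + psi_phi G x v.
Proof.
apply: psi_phi_leP => i.
apply: le_trans (lerD (psi_phi_comp_le x u i) (psi_phi_comp_le x v i)).
rewrite /psi_phi_comp dotDr; set g := gH_grad_hi _ _ - _.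
have : dot g (vabs (u + v)) <= dot g (vabs u + vabs v).
  by apply: ler_dot => j; [exact: gH_grad_width_ge0|rewrite !mxE ler_normD].
by rewrite dotDr; lra.
Qed.

Lemma psi_phiZ_le x v (a : R) : 0 <= a ->
  psi_phi G x (a *: v) <= a * psi_phi G x v.
Proof.
move=> a0; apply: psi_phi_leP => i.
apply: le_trans (ler_wpM2l a0 (psi_phi_comp_le x v i)).
rewrite /psi_phi_comp.
have -> : vabs (a *: v) = a *: vabs v.
  by apply/rowP => j; rewrite !mxE normrM (ger0_norm a0).
by rewrite !dotZr; lra.
Qed.

Lemma psi_phi0_le x : psi_phi G x 0 <= 0.
Proof. by have := psi_phiZ_le x 0 0 (lexx 0); rewrite scale0r mul0r. Qed.

(** The derivative at a point depends only on the gradient intervals there, so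
Lipschitz gradients make it Lipschitz in the point with no mean value argument
along the segment from [x] to [y].  Each of the two halves in the formula of [psi_phi_comp] contributes
[L * enorm (x - y) * enorm v]. *)
Lemma psi_phi_lipschitz (D : set 'rV[R]_n) (L : R) x y v :
  (forall i, gH_grad_lipschitz_on D L (G i)) -> D x -> D y ->
  psi_phi G x v <= psi_phi G y v + 2 * L * enorm (x - y) * enorm v.
Proof.
move=> lip Dx Dy; apply: psi_phi_leP => i.
apply: le_trans (lerD (psi_phi_comp_le y v i) (lexx _)).
have [] := lip i x y Dx Dy; rewrite /psi_phi_comp.
set lx := gH_grad_lo _ x; set ly := gH_grad_lo _ y.
set hx := gH_grad_hi _ x; set hy := gH_grad_hi _ y => lo_lip hi_lip.
have := dot_le_enorm _ v _ lo_lip.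
have := dot_le_enorm _ v _ hi_lip.
have := dot_le_enorm _ (vabs v) _ hi_lip.
(* The lower gradients occur with both signs, paired with v and with |v|. *)
have : dot ((-1) *: (lx - ly)) (vabs v) <= L * enorm (x - y) * enorm (vabs v).
  by apply: dot_le_enorm; rewrite enormZ normrN1 mul1r.
rewrite enorm_vabs dotZl !dotBl !dotDl; lra.
Qed.

(** The objective is at most [0] at its minimizer, because it is at most [0] at
the vector [0].  That [vdir G x] is not the default value [0] of
[xget] already shows that a minimizer exists. *)
Lemma psi_phi_vdir x : vdir G x != 0 ->
  psi_phi G x (vdir G x) <= - (2^-1 * enorm (vdir G x) ^+ 2).
Proof.
rewrite /vdir; case: xgetP => [v _ vmin _|_ /eqP//].
have := vmin 0; rewrite /dir_objective enorm0 expr0n mulr0 addr0.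
by have := psi_phi0_le x; lra.
Qed.

End psi_phi_theory.

(** * The conjugacy parameter *)

(** Here [a], [b], [c] stand for the generalized derivatives at the new point
along the new steepest descent direction, at the new point along the old search
direction, and at the old point along the old search direction.  The equation
[beta * (b - zeta * c) = - a] is the identity
[a + beta * b = zeta * c * beta], and [b - zeta * c <= (sigma + zeta) * - c]
gives the last bound. *)
Lemma mDY_scalar {R : realType} (sigma zeta a b c : R) : 0 < sigma -> sigma < zeta ->
  a < 0 -> c < 0 -> `|b| <= sigma * `|c| ->
  let beta := - a / (b - zeta * c) in
  [/\ 0 <= beta, a + beta * b = zeta * c * beta &
      zeta * c * beta <= zeta / (sigma + zeta) * a].
Proof.
move=> s0 sz a0 c0; rewrite (ltr0_norm c0) ler_norml => /andP[bl bu] beta.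
have zc : 0 < (zeta - sigma) * - c.
  by rewrite mulr_gt0 ?subr_gt0 ?oppr_gt0.
have D0 : 0 < b - zeta * c by lra.
have Db : beta * (b - zeta * c) = - a by rewrite /beta divfK ?gt_eqF.
have beta0 : 0 <= beta by rewrite divr_ge0 ?oppr_ge0 ?ltW.
move: beta Db beta0 => beta Db beta0.
split=> //; first by lra.
rewrite [leRHS]mulrAC ler_pdivlMr; last by lra.
have : 0 <= zeta * (beta * (sigma * - c - b)).
  by rewrite !mulr_ge0 //; lra.
by move: Db => /(congr1 ( *%R zeta)); lra.
Qed.

(** * Real sequences *)

Section real_sequences.
Context {R : realType}.

Lemma unbounded_descent (u : nat -> R) (delta l : R) (K : nat) : 0 < delta ->
  (forall k, (K <= k)%N -> u k.+1 <= u k - delta) -> ~ (forall k, l <= u k).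
Proof.
move=> d0 dec lb.
have lin j : u (K + j)%N <= u K - delta * j%:R.
  elim: j => [|j IH]; first by rewrite addn0 mulr0 subr0.
  have := dec _ (leq_addr j K); rewrite addnS -natr1; lra.
have quot_ge0 : 0 <= (u K - l) / delta by rewrite divr_ge0 ?subr_ge0 ?lb ?ltW.
have := archi_boundP quot_ge0; set j := Num.bound _.
rewrite ltr_pdivrMr // => hj.
by have := lin j; have := lb (K + j)%N; lra.
Qed.

(** All the tail infima vanish, not only their limit: a positive tail infimum
would keep the sequence away from [0]. *)
Lemma limn_einf_eq0 (u : nat -> R) : (forall k, 0 <= u k) ->
  (forall (gamma : R) (K : nat), 0 < gamma ->
    (forall k, (K <= k)%N -> gamma <= u k) -> False) ->
  limn_einf (fun k => (u k)%:E) = 0%E.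
Proof.
move=> u0 away; rewrite limn_einf_lim.
have -> : einfs (fun k => (u k)%:E) = cst 0%E.
  apply/funext => K; apply/eqP; rewrite eq_le; apply/andP; split; last first.
    by apply/ereal_infP => _ [k _ <-]; rewrite lee_fin.
  rewrite leNgt; apply/negP => inf_gt0.
  have [gamma gamma0 gamma_le] : exists2 gamma : R, 0 < gamma &
      (gamma%:E <= einfs (fun k => (u k)%:E) K)%E.
    case: (einfs _ K) inf_gt0 => [r| |//]; first by rewrite lte_fin; exists r.
    by exists 1; rewrite ?leey.
  apply: (away gamma K gamma0) => k Kk; rewrite -lee_fin.
  by apply: le_trans gamma_le _; apply: ereal_inf_lbound; exists k.
exact: lim_cst.
Qed.

End real_sequences.

(** * The conjugate gradient iteration *)

Section mDY_scheme.
Context {R : realType} {m n : nat}.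
Variables (G : 'I_m.+1 -> 'rV[R]_n -> cbitv R) (rho sigma zeta : R).
Variables (x d : nat -> 'rV[R]_n) (t beta : nat -> R).
Hypotheses (rho_gt0 : 0 < rho) (sigma_gt0 : 0 < sigma) (sigma_lt1 : sigma < 1).
Hypothesis zeta_gt1 : 1 < zeta.
Hypothesis scheme : ncg_scheme G beta x d t.
Hypothesis beta_def :
  forall k, beta k.+1 = beta_mDY G zeta (x k) (x k.+1) (d k).
Hypothesis wolfe : forall k, strong_wolfe G rho sigma (x k) (d k) (t k).

Local Notation f k := (psi_phi G (x k) (d k)).
Local Notation v k := (vdir G (x k)).
(* One half from [psi_phi_vdir], the quotient from [mDY_scalar]. *)
Local Notation kappa := (2^-1 * (zeta / (sigma + zeta))).

Let zeta_gt0 : 0 < zeta.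
Proof. exact: lt_trans ltr01 zeta_gt1. Qed.

Let kappa_gt0 : 0 < kappa.
Proof.
by rewrite mulr_gt0 ?invr_gt0 // divr_gt0 // addr_gt0.
Qed.

Lemma scheme_step k : x k.+1 = x k + t k *: d k.
Proof. by have [_ _ /(_ k)[]] := scheme. Qed.

Lemma step_gt0 k : 0 < t k.
Proof. by have [_ _ /(_ k)[]] := scheme. Qed.

Lemma psi_phi_vdir_lt0 k : psi_phi G (x k) (v k) < 0.
Proof.
have [_ _ _ _ /(_ k) vk0] := scheme.
apply: le_lt_trans (psi_phi_vdir _ _ vk0) _.
by rewrite oppr_lt0 mulr_gt0 ?invr_gt0 // exprn_gt0 ?enorm_gt0.
Qed.

Lemma curvature k : `|psi_phi G (x k.+1) (d k)| <= sigma * `|f k|.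
Proof. by have [_] := wolfe k; rewrite scheme_step. Qed.

(** The second bound, read as [beta k.+1 <= `|f k.+1| / (zeta * `|f k|)],
controls the growth of the search directions; the third is the sufficient
descent property. *)
Lemma mDY_step k : f k < 0 ->
  [/\ 0 <= beta k.+1, f k.+1 <= zeta * f k * beta k.+1 &
      f k.+1 <= - (kappa * enorm (v k.+1) ^+ 2)].
Proof.
move=> fk0; have sz : sigma < zeta := lt_trans sigma_lt1 zeta_gt1.
have [] := mDY_scalar _ _ _ _ _ sigma_gt0 sz (psi_phi_vdir_lt0 k.+1) fk0
  (curvature k).
rewrite -/(beta_mDY G zeta (x k) (x k.+1) (d k)) -beta_def => b0 b_eq b_le.
have f_le : f k.+1 <= zeta * f k * beta k.+1.
  have [_ /(_ k) dS _ _ _] := scheme.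
  rewrite -b_eq dS (le_trans (psi_phi_subadd _ _ _ _)) //.
  by rewrite lerD2l psi_phiZ_le.
split=> //; apply: le_trans f_le (le_trans b_le _).
have [_ _ _ _ /(_ k.+1) vk0] := scheme.
have z0 : 0 <= zeta / (sigma + zeta).
  by rewrite ltW // divr_gt0 // addr_gt0.
by have := ler_wpM2l z0 (psi_phi_vdir _ _ vk0); lra.
Qed.

Lemma descent k : f k < 0.
Proof.
elim: k => [|k IH].
  by have [-> _ _ _ _] := scheme; exact: psi_phi_vdir_lt0.
have [_ _ f_le] := mDY_step k IH; apply: le_lt_trans f_le _.
have [_ _ _ _ /(_ k.+1) vk0] := scheme.
by rewrite oppr_lt0 mulr_gt0 // exprn_gt0 ?enorm_gt0.
Qed.

Lemma armijo k i :
  ilo (G i (x k.+1)) <= ilo (G i (x k)) + rho * t k * f k /\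
  ihi (G i (x k.+1)) <= ihi (G i (x k)) + rho * t k * f k.
Proof.
have [/(_ i)] := wolfe k; rewrite -scheme_step /ipreceq /= minxx maxxx => + _.
by rewrite [f k * _]mulrC.
Qed.

Lemma objective_decreasing k i : ipreceq (G i (x k.+1)) (G i (x k)).
Proof.
have [lo hi] := armijo k i.
have : 0 < rho * t k * - f k.
  by rewrite !mulr_gt0 ?oppr_gt0 ?step_gt0 ?descent.
by split; lra.
Qed.

Lemma iterate_level_set k : level_set G (x 0%N) (x k).
Proof.
elim: k => [|k IH] i; first by split.
have [lo hi] := objective_decreasing k i; have [lo0 hi0] := IH i.
by split; [exact: le_trans lo lo0|exact: le_trans hi hi0].
Qed.

(** The ratio [enorm (d k) / - f k] satisfies [r' <= B + r / zeta], with
[B := (kappa * gamma)^-1], so it stays below any [M] that bounds its first value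
and the fixed point [B * zeta / (zeta - 1)] of this affine map. *)
Lemma direction_bounded (gamma : R) (K : nat) : 0 < gamma ->
  (forall k, (K <= k)%N -> gamma <= enorm (v k)) ->
  exists2 M : R, 0 < M & forall k, (K <= k)%N -> enorm (d k) <= M * - f k.
Proof.
move=> gamma0 v_ge.
pose B := (kappa * gamma)^-1.
have kg0 : 0 < kappa * gamma := mulr_gt0 kappa_gt0 gamma0.
have B0 : 0 < B by rewrite invr_gt0.
pose M := Num.max (enorm (d K) / - f K) (B * zeta / (zeta - 1)).
have fK : 0 < - f K by rewrite oppr_gt0 descent.
have MB : B * zeta <= M * (zeta - 1).
  by rewrite -ler_pdivrMr ?subr_gt0 // le_max lexx orbT.
have M0 : 0 < M.
  have z1 : 0 < zeta - 1 by rewrite subr_gt0.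
  by rewrite -(pmulr_lgt0 _ z1) (lt_le_trans _ MB) // mulr_gt0.
exists M => // k /subnKC <-; elim: (k - K)%N => [|j IH].
  by rewrite addn0 -ler_pdivrMr // le_max lexx.
rewrite addnS; move: IH (leq_addr j K); move: (K + j)%N => k' IH Kk'.
have [b0 fb fv] := mDY_step k' (descent k').
have vB : enorm (v k'.+1) <= B * - f k'.+1.
  rewrite mulrC ler_pdivlMr //.
  have vg : gamma <= enorm (v k'.+1) := v_ge _ (leqW Kk').
  have := ler_wpM2l (enorm_ge0 (v k'.+1)) vg.
  by move=> /(ler_wpM2l (ltW kappa_gt0)); lra.
have [_ /(_ k') dS _ _ _] := scheme; rewrite {1}dS.
apply: le_trans (ler_enormD _ _) _; rewrite enormZ (ger0_norm b0).
rewrite -(ler_pM2l zeta_gt0).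
have := ler_wpM2l (ltW zeta_gt0) vB.
have := ler_wpM2l b0 IH => /(ler_wpM2l (ltW zeta_gt0)).
have := ler_wpM2l (ltW M0) fb.
have fS : 0 <= - f k'.+1 by rewrite oppr_ge0 ltW ?descent.
have := ler_wpM2r fS MB.
lra.
Qed.

(** The curvature condition forces the derivative along [d k] to increase by at
least [(1 - sigma) * - f k] over the step, while the Lipschitz gradients let it
increase by at most [2 * L * t k * enorm (d k) ^+ 2]. *)
Lemma step_lower_bound (L M : R) k : 0 < L -> 0 < M ->
  (forall i, gH_grad_lipschitz_on (level_set G (x 0%N)) L (G i)) ->
  enorm (d k) <= M * - f k -> (1 - sigma) / (2 * L * M ^+ 2) <= t k * - f k.
Proof.
move=> L0 M0 lip dM; have fk : 0 < - f k by rewrite oppr_gt0 descent.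
have t0 := step_gt0 k.
have := psi_phi_lipschitz _ _ _ _ _ (d k) lip
  (iterate_level_set k.+1) (iterate_level_set k).
rewrite {2}scheme_step addrAC subrr add0r enormZ (gtr0_norm t0).
have := curvature k; rewrite -[`|f k|]normrN (gtr0_norm fk) ler_norml.
move=> /andP[curv _] lipk.
rewrite ler_pdivrMr ?mulr_gt0 ?exprn_gt0 // -(ler_pM2r fk).
have dd : enorm (d k) * enorm (d k) <= (M * - f k) * (M * - f k).
  by rewrite ler_pM ?enorm_ge0.
have Lt : 0 <= 2 * L * t k by rewrite !mulr_ge0 ?ltW.
have := ler_wpM2l Lt dd; rewrite expr2; lra.
Qed.

Lemma vdir_not_bounded_away (L l gamma : R) (K : nat) : 0 < L ->
  (forall i, gH_grad_lipschitz_on (level_set G (x 0%N)) L (G i)) ->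
  (forall k, l <= ilo (G ord0 (x k))) -> 0 < gamma ->
  ~ (forall k, (K <= k)%N -> gamma <= enorm (v k)).
Proof.
move=> L0 lip bounded gamma0 v_ge.
have [M M0 dM] := direction_bounded gamma K gamma0 v_ge.
pose delta := rho * ((1 - sigma) / (2 * L * M ^+ 2)).
have delta0 : 0 < delta.
  by rewrite mulr_gt0 // divr_gt0 ?subr_gt0 // !mulr_gt0 ?exprn_gt0.
apply: (@unbounded_descent _ (fun k => ilo (G ord0 (x k))) delta l K delta0)
  => [k Kk|//].
have [lo _] := armijo k ord0; apply: le_trans lo _.
rewrite lerD2l -mulrA -[leLHS]opprK lerN2 -!mulrN ler_pM2l //.
by apply: step_lower_bound => //; exact: dM.
Qed.

End mDY_scheme.

Theorem theorem4p5 (R : realType) (m n : nat) (rho sigma zeta : R)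
    (G : 'I_m.+1 -> 'rV[R]_n -> cbitv R)
    (x d : nat -> 'rV[R]_n) (t beta : nat -> R)
    (hrho : 0 < rho) (hrhosigma : rho < sigma) (hsigma : sigma < 1)
    (hzeta : 1 < zeta)
    (hG : forall i, gH_continuously_differentiable (G i))
    (hscheme : ncg_scheme G beta x d t)
    (hlip : forall i, exists L : R,
        gH_grad_lipschitz_on (level_set G (x 0%N)) L (G i))
    (hbdd : forall y : nat -> 'rV[R]_n,
        (forall k, level_set G (x 0%N) (y k)) ->
        (forall k i, ipreceq (G i (y k.+1)) (G i (y k))) ->
        exists Glow : 'I_m.+1 -> cbitv R,
          forall k i, ipreceq (Glow i) (G i (y k)))
    (hbeta : forall k, beta k.+1 = beta_mDY G zeta (x k) (x k.+1) (d k))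
    (hwolfe : forall k, strong_wolfe G rho sigma (x k) (d k) (t k)) :
  limn_einf (fun k => (enorm (vdir G (x k)))%:E) = 0%E.
Proof.
have sigma0 : 0 < sigma by lra.
(* A single constant for all the objectives; the 1 makes it positive, as the
   given constants may be 0 or negative. *)
have [L L0 lip] : exists2 L : R, 0 < L &
    forall i, gH_grad_lipschitz_on (level_set G (x 0%N)) L (G i).
  have [Li lip] := boolp.choice hlip.
  exists (1 + \sum_i `|Li i|).
    by rewrite ltr_pwDl // sumr_ge0.
  move=> i y z Dy Dz; have [lo hi] := lip i y z Dy Dz.
  have Li_le : Li i <= 1 + \sum_i `|Li i|.
    rewrite (bigD1 i) //= (le_trans (ler_norm _)) // addrCA lerDl.
    by rewrite addr_ge0 // sumr_ge0.
  by split; [apply: le_trans lo _|apply: le_trans hi _];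
    rewrite ler_wpM2r ?enorm_ge0.
have [Glow low] := hbdd x
  (iterate_level_set G rho sigma zeta x d t beta hrho sigma0 hsigma hzeta
    hscheme hbeta hwolfe)
  (objective_decreasing G rho sigma zeta x d t beta hrho sigma0 hsigma hzeta
    hscheme hbeta hwolfe).
apply: limn_einf_eq0 => [k|gamma K gamma0]; first exact: enorm_ge0.
apply: (vdir_not_bounded_away G rho sigma zeta x d t beta hrho sigma0 hsigma
  hzeta hscheme hbeta hwolfe L (ilo (Glow ord0)) gamma K L0 lip _ gamma0) => k.
by have [] := low k ord0.
Qed.
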